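(* Let $A$ be a square matrix over $\mathbb{Q}$, let $\epsilon\in\{1,-1\}$, let $\alpha=(s_1,\ldots,s_r)$ with $s_n=\pm1$ and $n_\alpha=\sum_n s_n$. Let $\phi\in\mathbb{R}$ be such that $e^{ik\phi}\neq1$ for $k=1,\ldots,r$. Suppose that $n_\alpha\neq0$ or $A-\epsilon A^T$ is nonsingular. Then: (1) if $\epsilon=1$, $\ \sigma^+_{i^+_\alpha A}(\phi)=\sigma^+_A(n_\alpha\phi)$; (2) if $\epsilon=-1$, $\ \sigma^-_{i^-_\alpha A}(\phi)=\eta_{n_\alpha}(\phi)\cdot\operatorname{sign}(A+A^T)+\sigma^-_A(n_\alpha\phi)$.
   Context: For a square matrix $A$ over $\mathbb{Q}$, $\sigma^{\pm}_A(\phi)=\operatorname{sign}\big((1-e^{i\phi})A+\epsilon(1-e^{-i\phi})A^T\big)$ with $\epsilon=1$ for $\sigma^+$ and $\epsilon=-1$ for $\sigma^-$; the signature of an anti-hermitian matrix $P$ means the signature of the hermitian matrix $\sqrt{-1}\,P$. For $\alpha=(s_1,\ldots,s_r)$ with $s_n=\pm1$, $i^{+}_\alpha A$ (with $\epsilon=1$) and $i^-_\alpha A$ (with $\epsilon=-1$) denote the $r\times r$ block matrix whose $n$-th diagonal block is $A$ if $s_n=1$ and $\epsilon A^T$ if $s_n=-1$, all of whose blocks above the diagonal are $A$, and all of whose blocks below the diagonal are $\epsilon A^T$. For a positive integer $a$, $\eta_a\colon\mathbb{R}\to\mathbb{Z}$ is the step function of period $2\pi$ given by $\eta_a(\phi)=a+1-2k$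 if $2\pi(k-1)/a<\phi<2\pi k/a$ ($k=1,\ldots,a$), $\eta_a(\phi)=a-2k$ if $\phi=2\pi k/a$ ($k=1,\ldots,a-1$), and $\eta_a(0)=0$. For negative $a$, $\eta_a(\phi)=\eta_{-a}(-\phi)$, and $\eta_0=0$. *)

(* Defs.v *)
From HB Require Import structures.
From mathcomp Require Import all_boot all_order all_algebra.
From mathcomp Require Import complex.
From mathcomp Require Import all_classical all_reals all_analysis.

Set Implicit Arguments.
Unset Strict Implicit.
Unset Printing Implicit Defensive.

Import Order.TTheory GRing.Theory Num.Theory.
Local Open Scope ring_scope.
Local Open Scope sesquilinear_scope.

Section Signatures.
Variable R : realType.
Local Notation C := R[i].

(* The imaginary unit is the concrete one of R[i], so that the sign convention
   does not depend on the choice of 'i in a numClosedFieldType. *)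
Definition imag_unit : C := Complex 0 1.

Definition cexpi (x : R) : C := Complex (cos x) (sin x).

(* Number of positive minus number of negative eigenvalues, with multiplicity.
   spectral_diag lists the eigenvalues of a normal matrix; on C, the order
   0 < z means that z is real and positive. *)
Definition signature (n : nat) (H : 'M[C]_n) : int :=
  #|[set i | 0 < spectral_diag H 0 i]|%:Z
  - #|[set i | spectral_diag H 0 i < 0]|%:Z.

Definition ratmx (n : nat) (A : 'M[rat]_n) : 'M[C]_n := map_mx ratr A.

Definition twisted_mx (eps : int) (n : nat) (A : 'M[rat]_n) (phi : R) : 'M[C]_n :=
  (1 - cexpi phi) *: ratmx A
  + eps%:~R *: ((1 - cexpi (- phi)) *: (ratmx A)^T).

Definition sigma_plus (n : nat) (A : 'M[rat]_n) (phi : R) : int :=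
  signature (twisted_mx 1 A phi).

(* twisted_mx (-1) A phi is anti-hermitian: its signature is that of its
   product with the imaginary unit. *)
Definition sigma_minus (n : nat) (A : 'M[rat]_n) (phi : R) : int :=
  signature (imag_unit *: twisted_mx (-1) A phi).

(* The representative of phi modulo 2 pi in [0, 2 pi). *)
Definition reduced_angle (phi : R) : R :=
  phi - 2 * pi * (Num.floor (phi / (2 * pi)))%:~R.

(* With psi the reduced angle and t := a psi / (2 pi), one has psi = 2 pi k / a
   iff t = k, and 2 pi (k - 1) / a < psi < 2 pi k / a iff k - 1 < t < k; in both
   cases k is the ceiling of t. *)
Definition eta_nat (a : nat) (phi : R) : int :=
  let psi := reduced_angle phi in
  let t := a%:R * psi / (2 * pi) in
  let k := Num.ceil t in
  if psi == 0 then 0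
  else if t \is a Num.int then a%:Z - 2 * k
  else a%:Z + 1 - 2 * k.

Definition eta_step (a : int) (phi : R) : int :=
  if 0 <= a then eta_nat `|a|%N phi else eta_nat `|a|%N (- phi).

End Signatures.

Definition ialpha (eps : int) (r : nat) (s : 'I_r -> int) (m : nat)
    (A : 'M[rat]_m) : 'M[rat]_(\sum_(i < r) m) :=
  \mxblock_(i < r, j < r)
    (if (i < j)%N then A
     else if (j < i)%N then eps%:~R *: A^T
     else if s i == 1 then A else eps%:~R *: A^T).

Section Checks.
Variable R : realType.
Implicit Types phi : R.

Let twopi_gt0 : 0 < 2 * pi :> R.
Proof. by rewrite mulr_gt0// pi_gt0. Qed.

Lemma reduced_angle_id phi : 0 <= phi < 2 * pi -> reduced_angle phi = phi.
Proof.
case/andP=> p0 p2; rewrite /reduced_angle (@Num.Theory.floor_def _ _ 0) ?mulr0 ?subr0//.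
by rewrite add0r divr_ge0 ?(ltW twopi_gt0)//= ltr_pdivrMr// mul1r.
Qed.

Lemma reduced_angle_periodic phi : reduced_angle (phi + 2 * pi) = reduced_angle phi.
Proof.
rewrite /reduced_angle.
have -> : (phi + 2 * pi) / (2 * pi) = phi / (2 * pi) + 1%:~R.
  by rewrite mulrDl divff ?gt_eqF.
rewrite floorDrz ?intr_int// intrKfloor intrD.
set w := 2 * pi; set q := Num.floor _.
by rewrite mulrDr rmorph1 mulr1 opprD addrACA subrr addr0.
Qed.

Lemma eta_nat_periodic a phi : eta_nat a (phi + 2 * pi) = eta_nat a phi.
Proof. by rewrite /eta_nat reduced_angle_periodic. Qed.

Lemma eta_nat0 a : eta_nat a (0 : R) = 0.
Proof. by rewrite /eta_nat reduced_angle_id ?lexx//= eqxx. Qed.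

Lemma eta_nat_open a k phi : (0 < k <= a)%N ->
  2 * pi * (k%:R - 1) / a%:R < phi < 2 * pi * k%:R / a%:R ->
  eta_nat a phi = a%:Z + 1 - 2 * k%:Z.
Proof.
move=> /andP[k0 ka] /andP[p1 p2].
have a0 : 0 < a%:R :> R by rewrite ltr0n (leq_trans k0).
have phi0 : 0 < phi.
  by apply: le_lt_trans p1; rewrite divr_ge0 ?(ltW a0)// mulr_ge0 ?(ltW twopi_gt0)// subr_ge0 ler1n.
have phi2 : phi < 2 * pi.
  by apply: (lt_le_trans p2); rewrite ler_pdivrMr// ler_pM2l// ler_nat.
rewrite /eta_nat reduced_angle_id ?(ltW phi0)// gt_eqF//.
set t := a%:R * phi / (2 * pi).
have t1 : k%:R - 1 < t by rewrite /t ltr_pdivlMr// mulrC [ltRHS]mulrC -ltr_pdivrMr.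
have t2 : t < k%:R by rewrite /t ltr_pdivrMr// mulrC [ltRHS]mulrC -ltr_pdivlMr.
have -> : Num.ceil t = k%:Z.
  by apply: ceil_def; rewrite intrB -!pmulrn t1 (ltW t2).
case: ifPn => // /intrP[n tn]; exfalso.
have kn : k%:Z - 1 < n by rewrite -(ltr_int R) intrB -!pmulrn -tn.
have nk : n < k%:Z by rewrite -(ltr_int R) -!pmulrn -tn.
by move: kn; rewrite ltrBlDr ltzD1 leNgt nk.
Qed.

Lemma eta_nat_point a k phi : (0 < k < a)%N ->
  phi = 2 * pi * k%:R / a%:R -> eta_nat a phi = a%:Z - 2 * k%:Z.
Proof.
move=> /andP[k0 ka] ->.
have a0 : 0 < a%:R :> R by rewrite ltr0n (ltn_trans k0).
have phi0 : 0 < 2 * pi * k%:R / a%:R :> R by rewrite divr_gt0// mulr_gt0// ltr0n.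
have phi2 : 2 * pi * k%:R / a%:R < 2 * pi :> R.
  by rewrite ltr_pdivrMr// ltr_pM2l// ltr_nat.
rewrite /eta_nat reduced_angle_id ?(ltW phi0)// gt_eqF//.
have -> : a%:R * (2 * pi * k%:R / a%:R) / (2 * pi) = k%:R :> R.
  by rewrite [a%:R * _]mulrC divfK ?gt_eqF// [2 * pi * _]mulrC mulfK ?gt_eqF.
have -> : Num.ceil (k%:R : R) = k%:Z by exact: (intrKceil k%:Z).
by rewrite natr_int.
Qed.

Lemma eta_step0 phi : eta_step 0 phi = 0.
Proof.
rewrite /eta_step lexx /eta_nat absz0 !mul0r.
by case: ifP => // _; rewrite int_num0 ceil0.
Qed.

Lemma eta_step_opp (a : int) phi : a < 0 -> eta_step a phi = eta_step (- a) (- phi).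
Proof. by move=> a0; rewrite /eta_step leNgt a0 /= oppr_ge0 ltW// abszN. Qed.

Lemma conj_cexpi phi : (cexpi phi)^* = cexpi (- phi).
Proof. by rewrite /cexpi cosN sinN. Qed.

Lemma twisted_mx_adjoint (eps : int) n (A : 'M[rat]_n) phi :
  eps = 1 \/ eps = -1 ->
  (twisted_mx eps A phi) ^t* = eps%:~R *: twisted_mx eps A phi.
Proof.
move=> heps; rewrite /twisted_mx; apply/matrixP => i j; rewrite !mxE.
have conj_rat q : (ratr q : R[i])^* = ratr q by exact: fmorph_rat.
move: (ratr (A i j)) (ratr (A j i)) (conj_rat (A i j)) (conj_rat (A j i)) => x y xE yE.
rewrite rmorphD !rmorphM rmorph_int /= xE yE !rmorphB !rmorph1 /= !conj_cexpi opprK.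
by case: heps => ->; rewrite ?rmorphN1 ?rmorph1 ?mul1r ?mulN1r ?opprD ?opprK addrC.
Qed.

Lemma twisted_mx_hermitian n (A : 'M[rat]_n) phi :
  twisted_mx 1 A phi \is hermsymmx.
Proof.
apply/is_hermitianmxP; rewrite expr0 scale1r twisted_mx_adjoint ?scale1r//.
by left.
Qed.

Lemma twisted_mx_antihermitian n (A : 'M[rat]_n) phi :
  imag_unit R *: twisted_mx (-1) A phi \is hermsymmx.
Proof.
apply/is_hermitianmxP; rewrite expr0 scale1r linearZ /= map_mxZ.
rewrite twisted_mx_adjoint; last by right.
rewrite scalerA rmorphN1 mulrN1; congr (_ *: _).
by apply/eqP; rewrite eq_complex /= oppr0 opprK !eqxx.
Qed.

Lemma sym_ratmx_hermitian n (A : 'M[rat]_n) :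
  ratmx R (A + A^T) \is hermsymmx.
Proof.
apply/is_hermitianmxP; rewrite expr0 scale1r; apply/matrixP => i j.
by rewrite !mxE addrC; apply/esym; exact: fmorph_rat.
Qed.

End Checks.

(* Main.v *)
Require Import Defs.
From HB Require Import structures.
From mathcomp Require Import all_boot all_order all_algebra.
From mathcomp Require Import complex.
From mathcomp Require Import all_classical all_reals all_analysis.
From mathcomp Require Import ring lra zify.

(* Put z = 1 if eps = 1 and z = i if eps = -1, H = z (A + eps A^T) and
   S = -i z (A - eps A^T), both hermitian. With t = phi / 2, the form attached to
   i_alpha A is 2 sin^2 t times J (x) H + T (x) S, where J is the all-ones matrix
   and T has the s_j cot t on its diagonal, i above it and -i below it; the form
   attached to A at angle n phi is 2 sin^2 (n t) (H + cot (n t) S).  So only the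
   pair of scalar forms (J, T) has to be simplified, by congruence.
   Subtracting one of the first two basis vectors from the other gives a vector
   killed by J and T-orthogonal to all the remaining ones.  If the diagonal
   entries cot x and cot y of these two have nonzero sum, that vector splits off
   with value cot x + cot y and leaves cot (x + y) as new first diagonal entry; if
   the sum is zero, the two entries form a hyperbolic plane and disappear (if they
   are the only ones, this requires S to be nonsingular).
   The split off summands contribute sgn (cot (p t) + s cot t) sign S each, which
   is the increment of p |-> eta_p (phi) from p to p + s.  Finally sign S is 0 for
   eps = 1, because S is then i times a real matrix. *)

Set Implicit Arguments.
Unset Strict Implicit.
Unset Printing Implicit Defensive.

Import Order.TTheory GRing.Theory Num.Theory.
Local Open Scope ring_scope.
Local Open Scope sesquilinear_scope.

(** * Signature of a hermitian matrix and its invariance under congruence *)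

Section Inertia.
Variable C : numClosedFieldType.

Lemma adjmxM m n p (A : 'M[C]_(m, n)) (B : 'M[C]_(n, p)) :
  (A *m B) ^t* = B ^t* *m A ^t*.
Proof. by rewrite trmx_mul map_mxM. Qed.

Lemma diag_formE n (d y : 'rV[C]_n) :
  (y *m diag_mx d *m y ^t*) 0 0 = \sum_i d 0 i * `|y 0 i| ^+ 2.
Proof.
rewrite mul_mx_diag mxE; apply: eq_bigr => i _.
by rewrite !mxE normCK mulrAC mulrC.
Qed.

Definition npos n (d : 'rV[C]_n) := #|[set i | 0 < d 0 i]|.

(* Otherwise some nonzero vector supported on the positive coordinates of [e]
   would have an image vanishing on the positive coordinates of [d]. *)
Lemma npos_le n k (d : 'rV[C]_n) (e : 'rV[C]_k) (P : 'M[C]_(k, n)) :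
  d \is a mxOver Num.real ->
  diag_mx e = P *m diag_mx d *m P ^t* -> (npos e <= npos d)%N.
Proof.
move=> /mxOverP d_real eE; rewrite leqNgt; apply/negP => lt_de.
set I := [set i | 0 < e 0 i]; set J := [set j | 0 < d 0 j].
(* Right multiplication by [W] embeds the vectors supported on [I]; [Q] reads the coordinates in [J]
   of their images under [P]. *)
pose W : 'M[C]_(#|I|, k) := rowsub enum_val 1%:M.
pose Q := colsub (enum_val : 'I_(#|J|) -> _) (W *m P).
have : ~~ row_free Q.
  by rewrite /row_free neq_ltn (leq_ltn_trans (rank_leq_col _)).
rewrite -kermx_eq0 => /rowV0Pn[x /sub_kermxP xQ x_neq0].
pose z := x *m W.
have yJ j : 0 < d 0 j -> (z *m P) 0 j = 0.
  move=> dj; have jJ : j \in J by rewrite inE.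
  have /rowP/(_ (enum_rank_in jJ j)) := xQ.
  by rewrite /Q mulmx_colsub /z -mulmxA [in LHS]mxE [in RHS]mxE enum_rankK_in.
have : (z *m diag_mx e *m z ^t*) 0 0 <= 0.
  rewrite eE !mulmxA -mulmxA -adjmxM diag_formE; apply: sumr_le0 => j _.
  have [dj|dj] := boolP (0 < d 0 j); first by rewrite yJ// normr0 expr0n mulr0.
  by rewrite mulr_le0_ge0 ?exprn_ge0// real_leNgt ?real0.
have zE a : z 0 (enum_val a) = x 0 a.
  rewrite mxE (bigD1 a)//= !mxE eqxx mulr1 big1 ?addr0// => b /negPf ba.
  by rewrite !mxE (inj_eq enum_val_inj) ba mulr0.
have z0 i : i \notin I -> z 0 i = 0.
  move=> iI; rewrite mxE big1// => b _; rewrite !mxE.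
  by case: eqP (enum_valP b) iI => [->->|]; rewrite ?mulr0.
have [a xa] : exists a, x 0 a != 0.
  apply/existsP; apply: contraNT x_neq0; rewrite negb_exists => /forallP x0.
  by apply/eqP/rowP => a; move: (x0 a); rewrite negbK mxE => /eqP.
rewrite diag_formE (bigD1 (enum_val a))//= zE => /le_gtF/negP; apply.
apply: ltr_wpDr.
  apply: sumr_ge0 => i _; have [|iI] := boolP (i \in I).
    by rewrite inE => /ltW ?; rewrite mulr_ge0 ?exprn_ge0.
  by rewrite z0// normr0 expr0n mulr0.
have := enum_valP a; rewrite inE => ea.
by rewrite mulr_gt0// exprn_gt0// normr_gt0.
Qed.

Lemma mxOver_realN m n (d : 'M[C]_(m, n)) :
  d \is a mxOver Num.real -> - d \is a mxOver Num.real.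
Proof. by move=> /mxOverP dR; apply/mxOverP => i j; rewrite mxE rpredN. Qed.

Lemma diag_mxN n (d : 'rV[C]_n) : diag_mx (- d) = - diag_mx d.
Proof. by rewrite raddfN. Qed.

Lemma nposN n (d : 'rV[C]_n) : npos (- d) = #|[set i | d 0 i < 0]|.
Proof. by apply: eq_card => i; rewrite !inE mxE oppr_gt0. Qed.

Definition diag_sig n (d : 'rV[C]_n) : int := (npos d)%:Z - (npos (- d))%:Z.

(** Sylvester's law of inertia: [npos_le] in both directions, for the diagonals and for their
    opposites. Rectangular [P] and [Q] are allowed, so that bases with different index types can be
    compared. *)
Lemma diag_sig_congr n k (d : 'rV[C]_n) (e : 'rV[C]_k) P Q :
  d \is a mxOver Num.real -> e \is a mxOver Num.real ->
  diag_mx e = P *m diag_mx d *m P ^t* -> diag_mx d = Q *m diag_mx e *m Q ^t* ->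
  diag_sig e = diag_sig d.
Proof.
move=> dR eR eE dE; rewrite /diag_sig; congr (_%:Z - _%:Z); apply/eqP.
  by rewrite eqn_leq (npos_le dR eE) (npos_le eR dE).
rewrite eqn_leq (npos_le (P := P)) ?(npos_le (P := Q)) ?mxOver_realN// !diag_mxN mulmxN mulNmx.
  by rewrite -dE.
by rewrite -eE.
Qed.

Lemma diag_sig_row_mx n k (d : 'rV[C]_n) (e : 'rV[C]_k) :
  diag_sig (row_mx d e) = diag_sig d + diag_sig e.
Proof.
have nposD (d' : 'rV[C]_n) (e' : 'rV[C]_k) : npos (row_mx d' e') = (npos d' + npos e')%N.
  rewrite /npos -!sum1dep_card big_split_ord /=; congr addn;
  by apply: eq_bigl => i; rewrite ?row_mxEl ?row_mxEr.
by rewrite /diag_sig opp_row_mx !nposD !PoszD opprD addrACA.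
Qed.

Lemma diag_sigN n (d : 'rV[C]_n) : diag_sig (- d) = - diag_sig d.
Proof. by rewrite /diag_sig opprK opprB. Qed.

Definition hsig n (H : 'M[C]_n) := diag_sig (spectral_diag H).

Section Hermitian.
Variables (n : nat) (H : 'M[C]_n).
Hypothesis Hherm : H ^t* = H.

Let Hsym : H \is hermsymmx.
Proof. by apply/is_hermitianmxP; rewrite expr0 scale1r Hherm. Qed.

Lemma spectral_real : spectral_diag H \is a mxOver Num.real.
Proof. exact: hermitian_spectral_diag_real. Qed.

(** The doubled adjoint gives the shape [Q *m d *m Q ^t*] of the congruence lemmas. *)
Lemma spectralE :
  H = (spectralmx H) ^t* *m diag_mx (spectral_diag H) *m ((spectralmx H) ^t*) ^t*.
Proof.
have /hermitian_normalmx/orthomx_spectralP := Hsym.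
by rewrite trmxCK invmx_unitary ?spectral_unitarymx.
Qed.

Lemma spectral_diagE :
  diag_mx (spectral_diag H) = spectralmx H *m H *m (spectralmx H) ^t*.
Proof.
have /unitarymxP U := spectral_unitarymx H.
by rewrite [X in _ *m X *m _]spectralE !mulmxA U mul1mx trmxCK -mulmxA U mulmx1.
Qed.

Lemma hsig_diag k (d : 'rV[C]_k) P Q : d \is a mxOver Num.real ->
  diag_mx d = P *m H *m P ^t* -> H = Q *m diag_mx d *m Q ^t* -> hsig H = diag_sig d.
Proof.
move=> dR dE HE; apply/esym.
apply: (@diag_sig_congr _ _ _ _ (P *m (spectralmx H) ^t*) (spectralmx H *m Q)) => //.
- exact: spectral_real.
- by rewrite dE {1}spectralE !adjmxM !mulmxA.
- by rewrite spectral_diagE {2}HE !adjmxM !mulmxA.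
Qed.

End Hermitian.

Lemma hsig_congr n k (H : 'M[C]_n) (K : 'M[C]_k) P Q :
  H ^t* = H -> K = P *m H *m P ^t* -> H = Q *m K *m Q ^t* -> hsig K = hsig H.
Proof.
move=> Hh KE HE.
have Kh : K ^t* = K by rewrite KE !adjmxM trmxCK Hh mulmxA.
apply: (@hsig_diag _ _ Kh _ _ (spectralmx H *m Q) (P *m (spectralmx H) ^t*)).
- exact: spectral_real.
- by rewrite spectral_diagE// {2}HE !adjmxM !mulmxA.
- by rewrite KE {1}(spectralE Hh) !adjmxM !mulmxA.
Qed.

Lemma adj_block_mx a b c d (A : 'M[C]_(a, b)) (B : 'M[C]_(a, c)) (D : 'M[C]_(d, b)) E :
  (block_mx A B D E) ^t* = block_mx (A ^t*) (D ^t*) (B ^t*) (E ^t*).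
Proof. by rewrite tr_block_mx map_block_mx. Qed.

Lemma hsig_block_diag n k (H : 'M[C]_n) (K : 'M[C]_k) :
  H ^t* = H -> K ^t* = K -> hsig (block_mx H 0 0 K) = hsig H + hsig K.
Proof.
move=> Hh Kh; rewrite -diag_sig_row_mx.
apply: (@hsig_diag _ _ _ _ _ (block_mx (spectralmx H) 0 0 (spectralmx K))
  (block_mx ((spectralmx H) ^t*) 0 0 ((spectralmx K) ^t*))).
- by rewrite adj_block_mx Hh Kh !trmx0 !map_mx0.
- apply/mxOverP => i j; rewrite mxE.
  by case: splitP => ? _; exact: (mxOverP (spectral_real _)).
- rewrite diag_mx_row adj_block_mx !trmx0 !map_mx0 !mulmx_block.
  by rewrite !(mul0mx, mulmx0, addr0, add0r) -!spectral_diagE.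
- rewrite diag_mx_row adj_block_mx !trmx0 !map_mx0 !mulmx_block.
  by rewrite !(mul0mx, mulmx0, addr0, add0r) -!spectralE.
Qed.

Lemma adjmxN m n (A : 'M[C]_(m, n)) : (- A) ^t* = - A ^t*.
Proof. by rewrite linearN /= map_mxN. Qed.

Lemma adjmxD m n (A B : 'M[C]_(m, n)) : (A + B) ^t* = A ^t* + B ^t*.
Proof. by rewrite linearD /= map_mxD. Qed.

Lemma adjmxZ m n a (A : 'M[C]_(m, n)) : (a *: A) ^t* = a^* *: A ^t*.
Proof. by rewrite linearZ /= map_mxZ. Qed.

Lemma adjmx1 n : (1%:M : 'M[C]_n) ^t* = 1%:M.
Proof. by rewrite trmx1 map_mx1. Qed.

Lemma adjmx0 m n : (0 : 'M[C]_(m, n)) ^t* = 0.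
Proof. by rewrite trmx0 map_mx0. Qed.

Lemma hsigN n (H : 'M[C]_n) : H ^t* = H -> hsig (- H) = - hsig H.
Proof.
move=> Hh; rewrite -diag_sigN.
apply: (@hsig_diag _ _ _ _ _ (spectralmx H) ((spectralmx H) ^t*)).
- by rewrite adjmxN Hh.
- exact: mxOver_realN (spectral_real _).
- by rewrite diag_mxN spectral_diagE// mulmxN mulNmx.
- by rewrite diag_mxN mulmxN mulNmx {1}[H]spectralE// trmxCK.
Qed.

Lemma hsigZ n a (H : 'M[C]_n) : 0 < a -> H ^t* = H -> hsig (a *: H) = hsig H.
Proof.
move=> a0 Hh; set b := sqrtC a.
have b0 : b != 0 by rewrite sqrtC_eq0 gt_eqF.
have bb : b * b = a by rewrite -expr2 sqrtCK.
have bR : b^* = b by apply/CrealP/ger0_real; rewrite sqrtC_ge0 ltW.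
apply: (@hsig_congr _ _ _ _ b%:M (b^-1)%:M) => //.
  by rewrite tr_scalar_mx map_scalar_mx /= bR mul_scalar_mx mul_mx_scalar scalerA bb.
rewrite tr_scalar_mx map_scalar_mx /= fmorphV /= bR mul_scalar_mx mul_mx_scalar.
by rewrite !scalerA -bb mulrACA !mulVf// mulr1 scale1r.
Qed.

(** Conjugating a spectral decomposition entrywise leaves its real eigenvalues alone. *)
Lemma hsig_conj n (H : 'M[C]_n) : H ^t* = H -> hsig (map_mx Num.conj H) = hsig H.
Proof.
move=> Hh; have HT : map_mx Num.conj H = H^T.
  by rewrite -{1}Hh; apply/matrixP => i j; rewrite !mxE conjCK.
have dR : map_mx Num.conj (spectral_diag H) = spectral_diag H.
  by apply: realmxC; exact: spectral_real.
apply: (@hsig_diag _ _ _ _ _ (map_mx Num.conj (spectralmx H)) (map_mx Num.conj ((spectralmx H) ^t*))).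
- by rewrite HT trmxK HT.
- exact: spectral_real.
- by rewrite -[in LHS]dR -map_diag_mx spectral_diagE// !map_mxM -!map_trmx.
- by rewrite {1}[H]spectralE// !map_mxM map_diag_mx dR -!map_trmx.
Qed.

Lemma hsig0 n : hsig (0 : 'M[C]_n) = 0.
Proof.
suff: hsig (0 : 'M[C]_n) = - hsig (0 : 'M[C]_n).
  by move/eqP; rewrite -subr_eq0 opprK -mulr2n mulrn_eq0 => /eqP.
by rewrite -hsigN ?oppr0// adjmx0.
Qed.

(* Changing the sign of the second half of the basis turns the form into its
   opposite, after a shear [Y] has absorbed [D]. *)
Lemma hsig_hyperbolic n k (B : 'M[C]_(n, k)) (D : 'M[C]_k) Y :
  D ^t* = D -> Y *m B = D -> hsig (block_mx 0 B (B ^t*) D) = 0.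
Proof.
move=> Dh YB; set H := block_mx _ _ _ _.
have Hh : H ^t* = H by rewrite adj_block_mx adjmx0 trmxCK Dh.
have YB' : B ^t* *m Y ^t* = D by rewrite -adjmxM YB.
pose P : 'M[C]_(n + k) := block_mx 1%:M 0 Y (- 1%:M).
have PP : P *m P = 1%:M.
  rewrite /P mulmx_block !(mul0mx, mulmx0, addr0, add0r, mul1mx, mulmx1, mulNmx, mulmxN).
  by rewrite opprK subrr -scalar_mx_block.
have PH : P *m H *m P ^t* = - H.
  rewrite /P /H adj_block_mx adjmxN !adjmx1 adjmx0 !mulmx_block YB.
  rewrite !(mul0mx, mulmx0, addr0, add0r, mul1mx, mulmx1, mulNmx, mulmxN).
  by rewrite subrr subr0 YB' opp_block_mx oppr0.
have : hsig (- H) = hsig H.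
  apply: hsig_congr Hh (esym PH) (_ : _ = P *m _ *m _).
  by rewrite -PH !mulmxA PP mul1mx -mulmxA -adjmxM PP adjmx1 mulmx1.
by rewrite hsigN// => /eqP; rewrite eq_sym -subr_eq0 opprK -mulr2n mulrn_eq0 => /eqP.
Qed.

End Inertia.

(** * Kronecker products and splittings of pencils of forms *)

Section Kronecker.
Variables (C : numClosedFieldType) (m : nat).
Implicit Types B D : 'M[C]_m.

(** The Kronecker product, in the block layout of [ialpha] so that the two can be compared
    entrywise. *)
Definition kron r r' (p : 'M[C]_(r, r')) B : 'M[C]_(\sum_(i < r) m, \sum_(j < r') m) :=
  \mxblock_(i < r, j < r') (p i j *: B).

Lemma kronM q r t (a : 'M[C]_(q, r)) (b : 'M[C]_(r, t)) B D :
  kron a B *m kron b D = kron (a *m b) (B *m D).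
Proof.
rewrite /kron mul_mxblock; apply: eq_mxblock => i j.
rewrite mxE scaler_suml; apply: eq_bigr => l _.
by rewrite -scalemxAl -scalemxAr scalerA.
Qed.

Lemma kron_adj q r (a : 'M[C]_(q, r)) B : (kron a B) ^t* = kron (a ^t*) (B ^t*).
Proof.
by apply/matrixP => i j; rewrite !mxE rmorphM.
Qed.

Lemma kronDl q r (a b : 'M[C]_(q, r)) B : kron (a + b) B = kron a B + kron b B.
Proof.
rewrite /kron -mxblockD; by apply: eq_mxblock => i j; rewrite mxE scalerDl.
Qed.

Lemma kron0l q r B : kron (0 : 'M[C]_(q, r)) B = 0.
Proof. by apply: (addrI (kron 0 B)); rewrite -kronDl !addr0. Qed.

Lemma kron1 r : kron (1%:M : 'M[C]_r) 1%:M = 1%:M.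
Proof.
apply/matrixP => s t; rewrite /kron !mxE.
have [->|st] := eqVneq s t; first by rewrite !eqxx mulr1.
have [e1|] := eqVneq (tagnat.sig1 s) (tagnat.sig1 t); last by rewrite mul0r.
have [e2|] := eqVneq (tagnat.sig2 s : 'I_m) (tagnat.sig2 t); last by rewrite mulr0.
case/eqP: st; rewrite -(tagnat.sig2K s) -(tagnat.sig2K t).
(* The type of the second component depends on the first, so both equalities are substituted
   together. *)
have RankE i j (a b : 'I_m) : i = j -> a = b ->
    tagnat.Rank (p_ := fun=> m) i a = tagnat.Rank j b by move=> -> ->.
exact: RankE.
Qed.

(** The sizes [\sum_(i < 1) m] and [m] are different terms, so the comparison is a congruence, by
    the one-block column of the identity. *)
Lemma hsig_kron11 (p : 'M[C]_1) B : (p 0 0 *: B) ^t* = p 0 0 *: B ->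
  hsig (kron p B) = hsig (p 0 0 *: B).
Proof.
move=> pBh; pose P : 'M[C]_(\sum_(i < 1) m, m) := \mxcol_(i < 1) 1%:M.
have PE : P ^t* = \mxrow_(i < 1) 1%:M.
  by apply/matrixP => i j; rewrite !mxE eq_sym; case: eqP => _; rewrite ?rmorph1 ?rmorph0.
have kronE : kron p B = P *m (p 0 0 *: B) *m P ^t*.
  rewrite PE mxcol_mul mul_mxcol_mxrow; apply: eq_mxblock => i j.
  by rewrite !ord1 mul1mx mulmx1.
apply: (hsig_congr (Q := P ^t*) pBh kronE).
have PP : P ^t* *m P = 1%:M by rewrite PE mul_mxrow_mxcol big_ord1 mul1mx.
by rewrite kronE trmxCK !mulmxA PP mul1mx -mulmxA PP mulmx1.
Qed.

(** The rows of [F1] and [F2] together span the space, [row_mx E1 E2] being a left inverse of their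
    stack, and their Gram matrix is block diagonal. *)
Lemma hsig_split n n1 n2 (H : 'M[C]_n) (F1 : 'M[C]_(n1, n)) (F2 : 'M[C]_(n2, n)) E1 E2 :
  H ^t* = H -> E1 *m F1 + E2 *m F2 = 1%:M -> F1 *m H *m F2 ^t* = 0 ->
  hsig H = hsig (F1 *m H *m F1 ^t*) + hsig (F2 *m H *m F2 ^t*).
Proof.
move=> Hh EF FHF.
have FHF' : F2 *m H *m F1 ^t* = 0.
  by rewrite -(@adjmx0 C) -FHF !adjmxM trmxCK Hh mulmxA.
have FHh k (F : 'M[C]_(k, n)) : (F *m H *m F ^t*) ^t* = F *m H *m F ^t*.
  by rewrite !adjmxM trmxCK Hh mulmxA.
rewrite -hsig_block_diag ?FHh//.
apply/esym/(hsig_congr (P := col_mx F1 F2) (Q := row_mx E1 E2)) => //.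
  by rewrite mul_col_mx tr_col_mx map_row_mx mul_col_row FHF FHF'.
rewrite -{1}FHF -{1}FHF' -mul_col_row -mul_col_mx.
rewrite -map_row_mx -tr_col_mx !mulmxA mul_row_col EF mul1mx -mulmxA -adjmxM.
by rewrite mul_row_col EF adjmx1 mulmx1.
Qed.

Lemma hsig_split_hyperbolic n n1 n2 (H : 'M[C]_n) (F1 : 'M[C]_(n1, n)) (F2 : 'M[C]_(n2, n))
    E1 E2 Y :
  H ^t* = H -> E1 *m F1 + E2 *m F2 = 1%:M -> F1 *m H *m F1 ^t* = 0 ->
  Y *m (F1 *m H *m F2 ^t*) = F2 *m H *m F2 ^t* -> hsig H = 0.
Proof.
move=> Hh EF FHF FY.
have D_h : (F2 *m H *m F2 ^t*) ^t* = F2 *m H *m F2 ^t*.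
  by rewrite !adjmxM trmxCK Hh mulmxA.
rewrite -(hsig_hyperbolic D_h FY).
have -> : (F1 *m H *m F2 ^t*) ^t* = F2 *m H *m F1 ^t*.
  by rewrite !adjmxM trmxCK Hh mulmxA.
apply/esym/(hsig_congr (P := col_mx F1 F2) (Q := row_mx E1 E2)) => //.
  by rewrite mul_col_mx tr_col_mx map_row_mx mul_col_row FHF.
rewrite -{1}FHF -mul_col_row -mul_col_mx.
rewrite -map_row_mx -tr_col_mx !mulmxA mul_row_col EF mul1mx -mulmxA -adjmxM.
by rewrite mul_row_col EF adjmx1 mulmx1.
Qed.

Variables H S : 'M[C]_m.
Hypotheses (Hh : H ^t* = H) (Sh : S ^t* = S).

(** For [v] the all-ones column this is J (x) H + T (x) S; keeping [v] as a factor lets a change of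
    basis [F] act on it by [F *m v]. *)
Definition pencil_form k (v : 'cV[C]_k) T := kron (v *m v ^t*) H + kron T S.

Lemma pencil_form_adj k (v : 'cV_k) T : T ^t* = T -> (pencil_form v T) ^t* = pencil_form v T.
Proof. by move=> Th; rewrite adjmxD !kron_adj adjmxM trmxCK Th Hh Sh. Qed.

Lemma pencil_form_congr k k1 k2 (v : 'cV_k) T (F1 : 'M[C]_(k1, k)) (F2 : 'M[C]_(k2, k)) :
  kron F1 1%:M *m pencil_form v T *m (kron F2 1%:M) ^t* =
  kron (F1 *m v *m (F2 *m v) ^t*) H + kron (F1 *m T *m F2 ^t*) S.
Proof.
by rewrite kron_adj adjmx1 mulmxDr mulmxDl !kronM !mul1mx !mulmx1 adjmxM !mulmxA.
Qed.

Lemma hsig_pencil_form_split k k1 k2 (v : 'cV_k) T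
    (F1 : 'M[C]_(k1, k)) (F2 : 'M[C]_(k2, k)) E1 E2 :
  T ^t* = T -> E1 *m F1 + E2 *m F2 = 1%:M -> F2 *m v = 0 -> F1 *m T *m F2 ^t* = 0 ->
  hsig (pencil_form v T) =
    hsig (pencil_form (F1 *m v) (F1 *m T *m F1 ^t*)) + hsig (kron (F2 *m T *m F2 ^t*) S).
Proof.
move=> Th EF Fv FTF.
rewrite (@hsig_split _ _ _ _ (kron F1 1%:M) (kron F2 1%:M) (kron E1 1%:M) (kron E2 1%:M)).
- by rewrite !pencil_form_congr Fv mul0mx kron0l add0r.
- exact: pencil_form_adj.
- by rewrite !kronM mul1mx -kronDl EF kron1.
- by rewrite pencil_form_congr Fv FTF adjmx0 mulmx0 !kron0l addr0.
Qed.

Lemma hsig_pencil_form_hyperbolic k k1 k2 (v : 'cV_k) T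
    (F1 : 'M[C]_(k1, k)) (F2 : 'M[C]_(k2, k)) E1 E2 Y :
  T ^t* = T -> E1 *m F1 + E2 *m F2 = 1%:M -> F1 *m v = 0 -> F1 *m T *m F1 ^t* = 0 ->
  Y *m kron (F1 *m T *m F2 ^t*) S =
  kron (F2 *m v *m (F2 *m v) ^t*) H + kron (F2 *m T *m F2 ^t*) S ->
  hsig (pencil_form v T) = 0.
Proof.
move=> Th EF Fv FTF FY.
apply: (@hsig_split_hyperbolic _ _ _ _ (kron F1 1%:M) (kron F2 1%:M) (kron E1 1%:M) (kron E2 1%:M) Y).
- exact: pencil_form_adj.
- by rewrite !kronM mul1mx -kronDl EF kron1.
- by rewrite pencil_form_congr Fv FTF mul0mx !kron0l addr0.
- by rewrite !pencil_form_congr Fv mul0mx kron0l add0r FY.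
Qed.

End Kronecker.

(** * Reduction of the pencil by Schur complements and hyperbolic planes *)

Section Pencil.
Variables (C : numClosedFieldType) (im : C).
Hypotheses (im2 : im * im = -1) (conj_im : im^* = - im).

(** The matrix T with diagonal [c]; indexing [c] by [nat] allows the size to change without
    reindexing ordinals. *)
Definition pencil k (c : nat -> C) : 'M[C]_k :=
  \matrix_(i, j) if (i < j)%N then im else if (j < i)%N then - im else c i.

Lemma pencilD n k c : pencil (n + k) c =
  block_mx (pencil n c) (const_mx im) (const_mx (- im)) (pencil k (fun j => c (n + j)%N)).
Proof.
apply/matrixP => i j; rewrite mxE /block_mx !mxE.
case: splitP => i' ->; rewrite !mxE; case: splitP => j' ->; rewrite !mxE ?ltn_add2l//.
  by rewrite (leq_trans (ltn_ord i'))// leq_addr.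
by rewrite (leq_gtF (leq_trans (ltnW (ltn_ord j')) _)) ?leq_addr// (leq_trans (ltn_ord j')) ?leq_addr.
Qed.

Lemma pencil_herm k c : (forall n, (c n)^* = c n) -> (pencil k c) ^t* = pencil k c.
Proof.
move=> cR; apply/matrixP => i j; rewrite !mxE.
by case: ltngtP => [||/val_inj->]; rewrite ?rmorphN /= ?conj_im ?opprK ?cR.
Qed.

Lemma const_mx_adj k l (a : C) : (const_mx a : 'M[C]_(k, l)) ^t* = const_mx a^*.
Proof. by rewrite trmx_const map_const_mx. Qed.

Variables (m : nat) (H S : 'M[C]_m).
Hypotheses (Hh : H ^t* = H) (Sh : S ^t* = S).

Local Notation Gp k c := (hsig (pencil_form H S (const_mx 1) (pencil k c))).

(* The first n basis vectors are replaced by e_j - e_(n+1), on which the rank one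
   term vanishes and whose Gram matrix for T is N; the others are projected
   T-orthogonally to them, which changes only the first diagonal entry. *)
Lemma hsig_pencil_schur n k c (d := c n) (N := pencil n c + const_mx d) (x : 'cV_n) :
  (forall j, (c j)^* = c j) -> N \in unitmx -> N *m x = const_mx 1 ->
  Gp (n + k.+1) c =
  Gp k.+1 (fun j => if j is j'.+1 then c (n + j'.+1)%N
                    else d - (1 + d ^+ 2) * \sum_i x i 0) + hsig (kron N S).
Proof.
move=> cR Nu Nx; pose T : 'M[C]_k.+1 := pencil k.+1 (fun j => c (n + j)%N).
have [L Ldef] : {L : 'M[C]_(n, k.+1) | L = const_mx 1 *m delta_mx (0 : 'I_1) 0} by eexists.
have LE i j : L i j = (j == 0)%:R.
  by rewrite Ldef mxE big_ord1 !mxE mul1r.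
(* Every row of [L *m T] is the first row [(d, im, ..., im)] of [T], so e_j - e_(n+1) pairs to zero
   with all basis vectors after e_(n+1). *)
have LT : const_mx im - L *m T = (im - d) *: L.
  apply/matrixP => i j; rewrite [RHS]mxE LE !mxE (bigD1 0)//= LE mul1r big1; last first.
    by move=> l /negPf l0; rewrite LE l0 mul0r.
  rewrite mxE addr0; case: (eqVneq j 0) => [->|j0] /=; first by rewrite addn0 mulr1.
  by rewrite lt0n j0 subrr mulr0.
have LLc a : L *m const_mx a = const_mx a :> 'M[C]_n.
  apply/matrixP => i j; rewrite mxE (bigD1 0)//= LE !mxE mul1r big1 ?addr0//.
  by move=> l /negPf l0; rewrite LE l0 mul0r.
have LL : L *m L ^t* = const_mx 1.
  apply/matrixP => i j; rewrite mxE (bigD1 0)//= !mxE !LE eqxx mul1r rmorph1 big1 ?addr0//.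
  by move=> l /negPf l0; rewrite LE l0 mul0r.
pose t := (im - d) *: L.
(* Chosen so that subtracting [W *m F2] makes the last [k.+1] basis vectors orthogonal to the rows
   of [F2]. *)
pose W := t ^t* *m invmx N.
pose F1 : 'M[C]_(k.+1, n + k.+1) := row_mx (- W) (1%:M + W *m L).
pose F2 : 'M[C]_(n, n + k.+1) := row_mx 1%:M (- L).
have F2T : F2 *m pencil (n + k.+1) c = row_mx (pencil n c + const_mx im) t.
  rewrite pencilD mul_row_block !mul1mx !mulNmx LLc -/T LT.
  by congr (row_mx (_ + _) _); apply/matrixP => i j; rewrite !mxE opprK.
have F2TF2 : F2 *m pencil (n + k.+1) c *m F2 ^t* = N.
  rewrite F2T tr_row_mx map_col_mx mul_row_col adjmx1 mulmx1 adjmxN mulmxN.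
  rewrite -scalemxAl LL /N -addrA; congr (_ + _).
  by apply/matrixP => i j; rewrite !mxE mulr1 opprB addrC subrK.
have F1E : F1 = row_mx 0 1%:M - W *m F2.
  by rewrite mul_mx_row mulmx1 mulmxN opp_row_mx add_row_mx add0r opprK.
have ph : (pencil (n + k.+1) c) ^t* = pencil (n + k.+1) c by exact: pencil_herm.
have F1TF2 : F1 *m pencil (n + k.+1) c *m F2 ^t* = 0.
  have TF2 : pencil (n + k.+1) c *m F2 ^t* = (F2 *m pencil (n + k.+1) c) ^t*.
    by rewrite adjmxM ph.
  rewrite F1E !mulmxBl -!(mulmxA W) F2TF2 -mulmxA TF2 F2T.
  rewrite tr_row_mx map_col_mx mul_row_col mul0mx add0r mul1mx.
  by rewrite /W mulmxKV// subrr.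
have F1TF1 : F1 *m pencil (n + k.+1) c *m F1 ^t* = T - t ^t* *m invmx N *m t.
  rewrite {2}F1E adjmxD mulmxDr adjmxN mulmxN adjmxM mulmxA F1TF2 mul0mx subr0.
  rewrite F1E !mulmxBl -!(mulmxA W) F2T pencilD.
  rewrite tr_row_mx map_col_mx adjmx0 adjmx1 mul_row_block !mul_row_col.
  by rewrite !mulmx0 !mul0mx !mulmx1 !mul1mx !add0r.
have F2v : F2 *m const_mx 1 = 0 :> 'cV_n.
  rewrite -[const_mx 1]col_mx_const mul_row_col mul1mx mulNmx; apply/matrixP => i j.
  rewrite !mxE (bigD1 0)//= LE mxE mul1r big1 ?addr0 ?subrr//.
  by move=> l /negPf l0; rewrite LE l0 mul0r.
rewrite (@hsig_pencil_form_split _ _ _ _ Hh Sh _ _ _ _ _ F1 F2 (col_mx L 1%:M)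
  (col_mx (1%:M + L *m W) W)) //.
- rewrite F2TF2 F1TF1 F1E mulmxBl -(mulmxA W) F2v mulmx0 subr0.
  rewrite -{1}[const_mx 1](@col_mx_const _ n) mul_row_col mul0mx add0r mul1mx.
  congr (hsig (pencil_form _ _ _ _) + _).
  rewrite /t adjmxZ -!scalemxAl -scalemxAr scalerA.
  (* As [invmx N] sends the all-ones column to [x], the Schur correction is confined to the corner
     entry. *)
  have -> : L ^t* *m invmx N *m L = (\sum_i x i 0) *: delta_mx 0 0.
    rewrite Ldef adjmxM const_mx_adj rmorph1 mulmxA -!mulmxA (mulmxA (invmx N)).
    rewrite -Nx mulKmx// (mulmxA (const_mx 1)).
    have -> : const_mx 1 *m x = (\sum_i x i 0)%:M :> 'M[C]_1.
      apply/matrixP => i j; rewrite !mxE !ord1; apply: eq_bigr => l _.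
      by rewrite mxE mul1r.
    rewrite mul_scalar_mx -scalemxAr; congr (_ *: _).
    by rewrite trmx_delta map_delta_mx mul_delta_mx.
  rewrite scalerA; apply/matrixP => i j; rewrite !mxE.
  have -> : (im - d)^* * (im - d) = 1 + d ^+ 2.
    rewrite rmorphB /= conj_im cR.
    have -> : (- im - d) * (im - d) = - (im * im) + d ^+ 2 by ring.
    by rewrite im2 opprK.
  by case: i => [[|i] hi]; case: j => [[|j] hj]; rewrite /= ?mulr0 ?subr0 ?addn0 ?mulr1.
- rewrite !mul_col_row.
  rewrite !mulmx1 !mulmxN !mulmxDr !mulmx1 !mul1mx !mulmxDl !mul1mx add_block_mx.
  rewrite [RHS]scalar_mx_block; congr block_mx.
  + by rewrite addrCA addNr addr0.
  + by rewrite opprD addrACA subrr mulmxA subrr addr0.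
  + by rewrite addNr.
  + by rewrite addrK.
Qed.

Lemma eq_pencil k c c' : c =1 c' -> pencil k c = pencil k c'.
Proof. by move=> cc'; apply/matrixP => i j; rewrite !mxE cc'. Qed.

(** One vector is split off: [N] is the scalar [a + b], and [b - (1 + b ^+ 2) / (a + b)] simplifies
    to the cotangent addition formula. *)
Lemma hsig_pencil_merge k c (a := c 0) (b := c 1) : (forall j, (c j)^* = c j) -> a + b != 0 ->
  Gp k.+2 c =
  Gp k.+1 (fun j => if j is j'.+1 then c j'.+2 else (a * b - 1) / (a + b)) +
  hsig ((a + b) *: S).
Proof.
move=> cR u0; set N := pencil 1 c + const_mx b.
have N00 : N 0 0 = a + b by rewrite !mxE.
have NE : N = (a + b)%:M by rewrite [N]mx11_scalar N00.
have uR : (a + b)^* = a + b by rewrite rmorphD /= !cR.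
rewrite (@hsig_pencil_schur 1 k c (const_mx (a + b)^-1)) -/N //.
- rewrite hsig_kron11 N00; last by rewrite adjmxZ uR Sh.
  congr (hsig (pencil_form _ _ _ _) + _); apply: eq_pencil => -[|j] //.
  by rewrite big_ord1 mxE -/b; field.
- by rewrite NE unitmxE det_scalar1 unitfE.
- by rewrite NE mul_scalar_mx scalemx_const divff.
Qed.

Lemma sum_ord2 (F : 'I_2 -> C) : \sum_i F i = F 0 + F 1.
Proof. by rewrite !big_ord_recl big_ord0 addr0; congr (_ + F _); apply/val_inj. Qed.

(* [a] is the value of [T] on the pairs ((1, -1), (1, 0)) and ((1, -1), (0, 1)), so
   that (1, -1) is isotropic; the rank one term vanishes on it. *)
Lemma hsig_pencil_form_isotropic2 (T : 'M[C]_2) (v : 'cV_2) (a : C) :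
  T ^t* = T -> v 0 0 = v 1 0 -> v = 0 \/ S \in unitmx ->
  T 0 0 - T 1 0 = a -> T 0 1 - T 1 1 = a -> a != 0 -> hsig (pencil_form H S v T) = 0.
Proof.
move=> Th v01 vS Ta Tb a0.
pose F1 : 'M[C]_(1, 2) := \row_j (if j == 0 then 1 else -1).
pose F2 : 'M[C]_(1, 2) := \row_j (if j == 0 then 1 else 0).
pose E1 : 'M[C]_(2, 1) := \col_j (if j == 0 then 0 else -1).
pose E2 : 'M[C]_(2, 1) := \col_j 1.
pose p := F2 *m v *m (F2 *m v) ^t*.
have F12 : F1 *m T *m F2 ^t* = a%:M.
  rewrite [LHS]mx11_scalar; congr (_%:M).
  rewrite mxE sum_ord2 !mxE !sum_ord2 !mxE /=.
  by rewrite rmorph1 rmorph0 mulr0 addr0 mulr1 mul1r mulN1r.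
have aK b : (b / a)%:M *m a%:M = b%:M :> 'M[C]_1 by rewrite -scalar_mxM divfK.
(* With p and q the values of the rank one term and of [T] on (1, 0), the shear solves Y (a S) = p H
   + q S: [H] is reached through [H *m invmx S], and p vanishes when [v = 0]. *)
apply: (@hsig_pencil_form_hyperbolic _ _ _ _ Hh Sh _ _ _ _ _ F1 F2 E1 E2
  (kron (p 0 0 / a)%:M (H *m invmx S) + kron ((F2 *m T *m F2 ^t*) 0 0 / a)%:M 1%:M)) => //.
- apply/matrixP => i j; rewrite !mxE !big_ord1 !mxE.
  case: i => [[|[|//]] ?]; case: j => [[|[|//]] ?] //=;
  by rewrite ?mul0r ?mulN1r ?mulr1 ?mul1r ?opprK ?add0r ?addr0 ?addNr.
- apply/matrixP => i j.
  by rewrite !mxE sum_ord2 !mxE /= !ord1 mul1r mulN1r v01 subrr.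
- apply/matrixP => i j; rewrite mxE sum_ord2 !mxE !sum_ord2 !mxE /=.
  by rewrite rmorphN !rmorph1 !mul1r !mulN1r mulrN !mulr1 Ta Tb subrr.
- rewrite F12 mulmxDl !kronM !aK mul1mx -!mx11_scalar; congr (_ + _).
  case: vS => [v0|Su]; last by rewrite mulmxKV.
  by rewrite /p v0 mulmx0 mul0mx !kron0l.
Qed.

Lemma sqr_add1_neq0 (a : C) : a^* = a -> 1 + a ^+ 2 != 0.
Proof.
by move=> /CrealP aR; rewrite gt_eqF// ltr_wpDr// real_exprn_even_ge0.
Qed.

Lemma add_im_neq0 (a : C) : a^* = a -> a + im != 0.
Proof.
move=> aR; apply: contra_neq (sqr_add1_neq0 aR) => aim.
by rewrite -[1]opprK -im2 -(mul0r (a - im)) -aim; ring.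
Qed.

(** With only two vectors the rank one term survives on (1, 0), hence the invertibility of [S]. *)
Lemma hsig_pencil_cancel2 c : (forall j, (c j)^* = c j) -> c 1 = - c 0 -> S \in unitmx ->
  Gp 2 c = 0.
Proof.
move=> cR c1 Su; apply: (@hsig_pencil_form_isotropic2 _ _ (c 0 + im)).
- exact: pencil_herm.
- by rewrite !mxE.
- by right.
- by rewrite !mxE /= opprK.
- by rewrite !mxE /= c1 opprK addrC.
- exact: add_im_neq0.
Qed.

(** Two vectors are split off: their summand is hyperbolic, of signature 0, and the entries of [x]
    have sum 0, so the next diagonal entry [d] is kept. *)
Lemma hsig_pencil_cancel k c : (forall j, (c j)^* = c j) -> c 1 = - c 0 ->
  Gp k.+3 c = Gp k.+1 (fun j => c j.+2).
Proof.
move=> cR c1; set a := c 0 in c1; set d := c 2; set N := pencil 2 c + const_mx d.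
have aR : a^* = a by exact: cR.
have D0 := sqr_add1_neq0 aR.
have a0 : a - im != 0.
  by rewrite -aR -(opprK im) -conj_im opprK -rmorphD conjC_eq0 add_im_neq0.
have Nh : N ^t* = N by rewrite adjmxD pencil_herm// const_mx_adj cR.
(* The inverse of [N] by the adjugate formula; the determinant of [N] is -(1 + a^2), in which [d]
   cancels. *)
pose M : 'M[C]_2 := \matrix_(i, j)
   ((if i == 0 then if j == 0 then a - d else im + d
    else if j == 0 then d - im else - a - d) / (1 + a ^+ 2)).
pose x : 'cV[C]_2 := \col_i ((if i == 0 then 1 else -1) / (a - im)).
rewrite (@hsig_pencil_schur 2 k c x) -/N //.
- have -> : hsig (kron N S) = 0.
    have -> : kron N S = pencil_form H S 0 N by rewrite /pencil_form mul0mx kron0l add0r.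
    apply: (@hsig_pencil_form_isotropic2 _ _ (a + im)) => //.
    + by rewrite !mxE.
    + by left.
    + by rewrite !mxE /= -/a; ring.
    + by rewrite !mxE /= c1; ring.
    + exact: add_im_neq0.
  rewrite addr0; congr (hsig (pencil_form _ _ _ _)); apply: eq_pencil => -[|j] //.
  by rewrite sum_ord2 !mxE /= mulN1r mul1r subrr mulr0 subr0.
- have [] // := @mulmx1_unit _ _ N M.
  have DE : 1 + a ^+ 2 = a ^+ 2 - im * im by rewrite im2 opprK addrC.
  apply/matrixP => i j; rewrite !mxE sum_ord2 !mxE.
  case: i => [[|[|//]] ?]; case: j => [[|[|//]] ?] //=; rewrite -?/a ?c1.
  + by rewrite !mulrA -mulrDl -[RHS](divff D0) DE; congr (_ / _); ring.
  + by rewrite !mulrA -mulrDl -[RHS](mul0r (1 + a ^+ 2)^-1); congr (_ / _); ring.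
  + by rewrite !mulrA -mulrDl -[RHS](mul0r (1 + a ^+ 2)^-1); congr (_ / _); ring.
  + by rewrite !mulrA -mulrDl -[RHS](divff D0) DE; congr (_ / _); ring.
- apply/matrixP => i j; rewrite !mxE sum_ord2 !mxE.
  by case: i => [[|[|//]] ?] //=; rewrite ?c1 -/a; field.
Qed.

End Pencil.

(** * Cotangents and the step function at positive index *)

Section Cotangent.
Variable R : realType.
Implicit Types (x y phi : R) (z : int).

Definition cot x := cos x / sin x.

Lemma sin_intpi z : sin (z%:~R * pi) = 0 :> R.
Proof.
have sin_natpi n : sin (n%:R * pi) = 0 :> R.
  elim: n => [|n IH]; first by rewrite mul0r sin0.
  by rewrite -natr1 mulrDl mul1r sinDpi IH oppr0.
case: z => n; first exact: sin_natpi.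
by rewrite NegzE intrN mulNr sinN sin_natpi oppr0.
Qed.

Lemma cos_intpi_neq0 z : cos (z%:~R * pi) != 0 :> R.
Proof.
apply/eqP => c0; have := @cos2Dsin2 R (z%:~R * pi).
by rewrite c0 sin_intpi expr0n addr0 => /eqP; rewrite eq_sym oner_eq0.
Qed.

Lemma sinD_intpi x z : sin (x + z%:~R * pi) = sin x * cos (z%:~R * pi).
Proof. by rewrite sinD sin_intpi mulr0 addr0. Qed.

Lemma cotD_intpi x z : cot (x + z%:~R * pi) = cot x.
Proof.
rewrite /cot sinD_intpi cosD sin_intpi mulr0 subr0.
by rewrite -mulf_div divff ?mulr1// cos_intpi_neq0.
Qed.

Lemma cotN x : cot (- x) = - cot x.
Proof. by rewrite /cot cosN sinN invrN mulrN. Qed.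

Lemma cotDE x y : sin x != 0 -> sin y != 0 ->
  cot x + cot y = sin (x + y) / (sin x * sin y).
Proof.
by move=> sx sy; rewrite /cot addf_div// sinD addrC [sin x * cos y]mulrC [cos y * sin x]mulrC addrC.
Qed.

Lemma cotD x y : sin x != 0 -> sin y != 0 -> sin (x + y) != 0 ->
  (cot x * cot y - 1) / (cot x + cot y) = cot (x + y).
Proof.
move=> sx sy sxy; rewrite cotDE// /cot cosD.
by field; rewrite sxy sx sy.
Qed.

(** The ceiling matches the index [k] of [eta_nat]; a nonzero sine keeps [x] off the multiples of
    pi, so [y] is interior. *)
Lemma angle_itv x : sin x != 0 ->
  exists k y, 0 < y < pi /\ x = (k%:~R - 1) * pi + y.
Proof.
move=> sx; pose k := Num.ceil (x / pi); exists k, (x - (k%:~R - 1) * pi).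
split; last by ring.
have /andP[] := ceil_itv (x / pi); rewrite -/k intrB => k1 k2.
rewrite ltr_pdivlMr ?pi_gt0// in k1; rewrite ler_pdivrMr ?pi_gt0// in k2.
have {}k2 : x < k%:~R * pi.
  by rewrite lt_neqAle k2 andbT; apply: contra_neq sx => ->; rewrite sin_intpi.
by rewrite subr_gt0 k1/= mulrBl mul1r; lra.
Qed.

Lemma reduced_angle_bounds phi : 0 <= reduced_angle phi < 2 * pi.
Proof.
have : 0 < 2 * pi :> R by rewrite mulr_gt0// pi_gt0.
rewrite /reduced_angle; move: (2 * pi) => w w0.
have /andP[] := floor_itv (phi / w).
rewrite intrD ler_pdivlMr// ltr_pdivrMr// mulrDl mul1r => f1 f2.
by rewrite subr_ge0 mulrC f1 ltrBlDl.
Qed.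

Lemma reduced_angleE phi :
  phi / 2 = reduced_angle phi / 2 + (Num.floor (phi / (2 * pi)))%:~R * pi.
Proof. by rewrite /reduced_angle; set f := _%:~R; field. Qed.

(** The number whose ceiling [eta_nat] takes is [k - 1 + y / pi], strictly between consecutive
    integers, so the open-interval branch applies. *)
Lemma eta_natE (a : nat) phi (k : int) y : sin (phi / 2) != 0 -> 0 < y < pi ->
  a%:R * (reduced_angle phi / 2) = (k%:~R - 1) * pi + y ->
  eta_nat a phi = a%:Z + 1 - 2 * k.
Proof.
move=> sphi /andP[y0 ypi] aE; rewrite /eta_nat.
have pi0 : pi != 0 :> R by rewrite gt_eqF// pi_gt0.
have -> : (reduced_angle phi == 0) = false.
  apply: contraNF sphi => /eqP r0.
  by rewrite reduced_angleE r0 mul0r add0r sin_intpi.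
have -> : a%:R * reduced_angle phi / (2 * pi) = k%:~R - 1 + y / pi.
  have -> : a%:R * reduced_angle phi / (2 * pi) = a%:R * (reduced_angle phi / 2) / pi.
    by rewrite invfM !mulrA.
  by rewrite aE mulrDl mulfK.
have yp : 0 < y / pi < 1 by rewrite divr_gt0 ?pi_gt0//= ltr_pdivrMr ?pi_gt0// mul1r.
have ck : Num.ceil (k%:~R - 1 + y / pi) = k.
  by apply: ceil_def; rewrite intrB; lra.
rewrite ck; case: ifPn => // /intrP[n tn].
have : k = n by rewrite -ck tn intrKceil.
by move=> kn; exfalso; move: tn; rewrite kn; lra.
Qed.

Lemma eta_nat1 phi : sin (phi / 2) != 0 -> eta_nat 1 phi = 0.
Proof.
move=> sphi; have /andP[r0 r1] := reduced_angle_bounds phi.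
rewrite (@eta_natE 1 _ 1 (reduced_angle phi / 2))//.
- apply/andP; split; last by lra.
  rewrite divr_gt0// lt_neqAle r0 andbT.
  by apply: contraNneq sphi => r00; rewrite reduced_angleE -r00 mul0r add0r sin_intpi.
- by rewrite subrr mul0r add0r mul1r.
Qed.

(* With p b = y mod pi and 0 < y < pi, both sides change by 1 or -1 according to
   whether y + b is smaller or larger than pi. *)
Lemma eta_natS (p : nat) phi : (0 < p)%N -> sin (phi / 2) != 0 ->
  sin (p%:R * (phi / 2)) != 0 -> sin (p.+1%:R * (phi / 2)) != 0 ->
  eta_nat p.+1 phi = eta_nat p phi + sgz (cot (p%:R * (phi / 2)) + cot (phi / 2)).
Proof.
move=> p0 s1 sp sp1; set b := reduced_angle phi / 2; set q := Num.floor (phi / (2 * pi)).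
have bE : phi / 2 = b + q%:~R * pi by exact: reduced_angleE.
(* Multiples of [phi / 2] and of [b] agree modulo pi, which affects neither [cot] nor the vanishing
   of [sin]. *)
have natE (n : nat) : n%:R * (phi / 2) = n%:R * b + (n%:Z * q)%:~R * pi.
  by rewrite bE mulrDr intrM -mulrA.
have sinE n : sin (n%:R * (phi / 2)) != 0 -> sin (n%:R * b) != 0.
  by rewrite natE sinD_intpi mulf_eq0 negb_or => /andP[].
have sb : sin b != 0 by have := sinE 1%N; rewrite !mul1r; apply.
rewrite natE cotD_intpi bE cotD_intpi.
have [k [y [y_itv pbE]]] := angle_itv (sinE _ sp).
have pi0 := pi_gt0 R.
have b_itv : 0 < b < pi.
  have /andP[r0 r1] := reduced_angle_bounds phi.
  apply/andP; split; last by rewrite /b; lra.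
  rewrite lt_neqAle divr_ge0// andbT.
  by apply: contra_neq sb => <-; rewrite sin0.
have km1 : k%:~R - 1 = (k - 1)%:~R :> R by rewrite intrB.
rewrite (eta_natE s1 y_itv pbE) pbE km1 [_ * pi + y]addrC cotD_intpi.
have sy0 : 0 < sin y by exact: sin_gt0_pi.
have sb0 : 0 < sin b by exact: sin_gt0_pi.
have p1bE : p.+1%:R * b = (k%:~R - 1) * pi + (y + b) by rewrite -natr1 mulrDl mul1r pbE addrA.
rewrite cotDE ?gt_eqF// sgzM (gtr0_sgz (x := (_)^-1)) ?invr_gt0 ?mulr_gt0// mulr1.
case/andP: b_itv => b0 b1; case/andP: y_itv => y0 y1.
have [yb|yb|yb] := ltgtP (y + b) pi.
- rewrite (@eta_natE p.+1 _ k (y + b))// ?yb ?addr_gt0// gtr0_sgz; last first.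
    by rewrite sin_gt0_pi// yb addr_gt0.
  by rewrite -addn1 PoszD; ring.
- rewrite (@eta_natE p.+1 _ (k + 1) (y + b - pi))//; last first.
  + by rewrite p1bE intrD; ring.
  + by apply/andP; split; lra.
  rewrite ltr0_sgz; first by rewrite -addn1 PoszD; ring.
  rewrite -[y + b](subrK pi) sinDpi oppr_lt0 sin_gt0_pi//.
  by apply/andP; split; lra.
- have := sinE _ sp1; rewrite p1bE km1 addrC sinD_intpi yb sinpi mul0r.
  by rewrite eqxx.
Qed.

End Cotangent.

(** * The step function at integer index *)

Section Eta.
Variable R : realType.
Implicit Types (phi : R).

(** Undoes [eta_natS]: by the addition formula the difference of cotangents is
    [- ((1 + b ^+ 2) / (a + b))], of sign opposite to [a + b]. *)
Lemma eta_nat_pred (p : nat) phi : (0 < p)%N -> sin (phi / 2) != 0 ->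
  sin (p%:R * (phi / 2)) != 0 -> sin (p.+1%:R * (phi / 2)) != 0 ->
  eta_nat p phi = eta_nat p.+1 phi + sgz (cot (p.+1%:R * (phi / 2)) - cot (phi / 2)).
Proof.
move=> p0 s1 sp sp1; rewrite (eta_natS p0 s1 sp sp1) -addrA.
have p1E : p.+1%:R * (phi / 2) = p%:R * (phi / 2) + phi / 2.
  by rewrite -natr1 mulrDl mul1r.
rewrite p1E in sp1 *.
have u0 : cot (p%:R * (phi / 2)) + cot (phi / 2) != 0.
  by rewrite cotDE// mulf_eq0 negb_or sp1 invr_eq0 mulf_eq0 negb_or sp s1.
rewrite -(cotD sp s1 sp1); move: u0; set a := cot (_ * _); set b := cot _ => u0.
have -> : (a * b - 1) / (a + b) - b = - ((1 + b ^+ 2) / (a + b)) by field.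
have b2 : 0 < 1 + b ^+ 2 by rewrite ltr_pwDl// sqr_ge0.
by rewrite sgzN sgzM (gtr0_sgz b2) mul1r -(sgz_sgr (_^-1)) sgrV sgz_sgr subrr addr0.
Qed.

Lemma eta_step1 (s : int) phi : s = 1 \/ s = -1 -> sin (phi / 2) != 0 ->
  eta_step s phi = 0.
Proof.
move=> [->|->] sp; first exact: eta_nat1.
by apply: (@eta_nat1 _ (- phi)); rewrite mulNr sinN oppr_eq0.
Qed.

Lemma eta_stepD (p s : int) phi (t := phi / 2) : p != 0 -> s = 1 \/ s = -1 -> p + s != 0 ->
  sin t != 0 -> sin (p%:~R * t) != 0 -> sin ((p + s)%:~R * t) != 0 ->
  eta_step (p + s) phi = eta_step p phi + sgz (cot (p%:~R * t) + cot (s%:~R * t)).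
Proof.
(* The case of a positive index, at any angle: it serves [p > 0] at [phi] and [p < 0] at [- phi]. *)
have pos (n : nat) (e : int) (x : R) (u := x / 2) : n%:Z != 0 -> e = 1 \/ e = -1 -> n%:Z + e != 0 ->
    sin u != 0 -> sin (n%:R * u) != 0 -> sin ((n%:Z + e)%:~R * u) != 0 ->
    eta_nat `|n%:Z + e| x = eta_nat n x + sgz (cot (n%:R * u) + cot (e%:~R * u)).
  case: n => // n _ [->|->] ne s1 sn sne.
    rewrite mul1r -PoszD addn1 /=; apply: eta_natS => //.
    by move: sne; rewrite -PoszD addn1.
  rewrite mulN1r cotN.
  have nE : n.+1%:Z + -1 = n%:Z by rewrite -addn1 PoszD addrK.
  rewrite nE /= in ne sne *.
  by apply: eta_nat_pred => //; rewrite lt0n.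
case: p => n p0 hs ps st sp sps.
  have n0 : (0 < n)%N by rewrite lt0n.
  rewrite {2}/eta_step /= -pos//; rewrite /eta_step ifT//.
  by case: n hs {p0 ps sp sps} n0 => // n [->|->] _; rewrite // -addn1 PoszD addrK.
have eta_opp (z : int) : z < 0 -> eta_step z phi = eta_nat `|- z| (- phi).
  by move=> z0; rewrite /eta_step leNgt z0 /= abszN.
have t_opp : - phi / 2 = - t by rewrite mulNr.
(* A negative [p] moved by [s] without reaching 0 stays negative, so both values of [eta_step] are
   reflected. *)
rewrite !eta_opp//; last first.
  by move: ps hs; rewrite NegzE => ps [es|->]; rewrite ?es; move: ps; lia.
have oppE : - (Negz n + s) = n.+1%:Z + - s by rewrite NegzE opprD opprK.
rewrite oppE pos //.
- congr (_ + sgz _); rewrite t_opp !mulrN.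
  by rewrite NegzE !intrN !mulNr opprK.
- by case: hs => ->; rewrite ?opprK; [right|left].
- by rewrite -oppE oppr_eq0.
- by rewrite t_opp sinN oppr_eq0.
- by rewrite t_opp mulrN -mulNr -[- _]/((Negz n)%:~R).
- by rewrite -oppE t_opp intrN mulrNN.
Qed.

End Eta.

(** * Signature of the cotangent pencil *)

Section Count.
Variable R : realType.
Local Notation C := R[i].
Local Notation im := (imag_unit R).

Lemma imag_unit2 : im * im = -1.
Proof. by apply/eqP; rewrite eq_complex /= !mul0r mulr0 mulr1 sub0r addr0 oppr0 !eqxx. Qed.

Lemma conj_imag_unit : im^* = - im.
Proof. by apply/eqP; rewrite eq_complex /= oppr0 !eqxx. Qed.

Lemma conj_real (x : R) : (x%:C%C : C)^* = x%:C%C.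
Proof. by apply/eqP; rewrite eq_complex /= oppr0 !eqxx. Qed.

Lemma signature_hsig n (H : 'M[C]_n) : signature H = hsig H.
Proof. by rewrite /hsig /diag_sig nposN. Qed.

Variables (m : nat) (H S : 'M[C]_m).
Hypotheses (Hh : H ^t* = H) (Sh : S ^t* = S).
Local Notation Gp k c := (hsig (pencil_form H S (const_mx 1) (pencil im k c))).

Lemma hsig_scale (u : R) : hsig (u%:C%C *: S) = sgz u * hsig S.
Proof.
case: (sgzP u) => [->|u0|u0]; first by rewrite scale0r hsig0 mul0r.
- by rewrite mul1r hsigZ// ltcR.
- rewrite mulN1r -[u]opprK rmorphN scaleNr hsigN; last by rewrite adjmxZ conj_real Sh.
  by rewrite hsigZ// ltcR oppr_gt0.
Qed.

Lemma hsig_pencil1 c : (c 0)^* = c 0 -> Gp 1 c = hsig (H + c 0 *: S).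
Proof.
move=> cR.
have -> : pencil_form H S (const_mx 1) (pencil im 1 c) = kron 1%:M (H + c 0%N *: S).
  rewrite /pencil_form /kron -mxblockD; apply: eq_mxblock => i j.
  by rewrite !ord1 !mxE big_ord1 !mxE rmorph1 mulr1 !scale1r.
by rewrite hsig_kron11 mxE scale1r// adjmxD adjmxZ Hh Sh cR.
Qed.

Variables (phi : R) (r : nat).
Let t := phi / 2.
Hypothesis sin_t : forall k : nat, (0 < k <= r)%N -> sin (k%:R * t) != 0.

Lemma sin_multiple_neq0 (z : int) : z != 0 -> (`|z| <= r)%N -> sin (z%:~R * t) != 0.
Proof.
case: z => n z0 zr; first by rewrite sin_t// lt0n z0.
by rewrite NegzE intrN mulNr sinN oppr_eq0 sin_t.
Qed.

Definition cot_multiple (z : int) : C := (cot (z%:~R * t))%:C%C.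

(** [p] is the partial sum already merged into the first diagonal entry; the signs in [s] are still
    to be processed. *)
Definition cot_coefs (p : int) (s : nat -> int) (j : nat) : C :=
  if j is j'.+1 then cot_multiple (s j') else cot_multiple p.

Lemma cot_coefs_real p s j : (cot_coefs p s j)^* = cot_coefs p s j.
Proof. by case: j => [|j]; rewrite conj_real. Qed.

(** Merge when [p + s 0] is nonzero, cancel otherwise; the bound by [r] keeps every sine met on the
    way nonzero. The case [n = 0] is set apart because [cot_multiple 0] is only the default value of
    a division by zero. *)
Lemma hsig_pencil k (p : int) (s : nat -> int) (n := p + \sum_(j < k) s j) :
  (forall j, s j = 1 \/ s j = -1) -> p != 0 -> (`|p| + k <= r)%N ->
  n != 0 \/ S \in unitmx ->
  Gp k.+1 (cot_coefs p s) = (if n == 0 then 0 else hsig (H + cot_multiple n *: S)) +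
    (eta_step n phi - eta_step p phi) * hsig S.
Proof.
(* Strong induction, because a cancellation consumes two signs. *)
rewrite /n {n}; have [N] := ubnP k; elim: N k p s => // N IH k p s kN hs p0 pkr nS.
have r1 : (0 < r)%N by apply: leq_trans pkr; rewrite addn_gt0 absz_gt0 p0.
have st : sin t != 0 by have := @sin_t 1; rewrite mul1r; apply; rewrite r1.
have sp : sin (p%:~R * t) != 0.
  by apply: sin_multiple_neq0 p0 _; apply: leq_trans pkr; rewrite leq_addr.
have ss j : sin ((s j)%:~R * t) != 0.
  by case: (hs j) => ->; rewrite ?mulN1r ?sinN ?oppr_eq0 ?mul1r.
case: k => [|k] in kN pkr nS *.
  by rewrite big_ord0 addr0 (negPf p0) subrr mul0r addr0 hsig_pencil1 ?conj_real.
pose s' j := s j.+1.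
have sumE : p + \sum_(i < k.+1) s i = p + s 0%N + \sum_(i < k) s' i.
  by rewrite big_ord_recl addrA.
rewrite {}sumE in nS *.
have [ps0|ps0] := eqVneq (p + s 0%N) 0; last first.
  have pskr : (`|(p + s 0%N)%R| + k <= r)%N by have := hs 0%N; lia.
  have sps : sin ((p + s 0%N)%:~R * t) != 0.
    by apply: sin_multiple_neq0 => //; apply: leq_trans pskr; rewrite leq_addr.
  have cE : cot_coefs p s 0 + cot_coefs p s 1 = (cot (p%:~R * t) + cot ((s 0%N)%:~R * t))%:C%C.
    by rewrite rmorphD.
  have cot_neq0 : cot (p%:~R * t) + cot ((s 0%N)%:~R * t) != 0.
    by rewrite cotDE// mulf_eq0 negb_or invr_eq0 mulf_eq0 negb_or sp ss -mulrDl -intrD sps.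
  rewrite (hsig_pencil_merge imag_unit2 conj_imag_unit Hh Sh _ (cot_coefs_real p s)); last first.
    by rewrite cE fmorph_eq0.
  rewrite cE hsig_scale (@eq_pencil _ _ _ _ (cot_coefs (p + s 0%N) s')); last first.
    case=> [|j] //=; have sps' : sin (p%:~R * t + (s 0%N)%:~R * t) != 0 by rewrite -mulrDl -intrD.
    rewrite /cot_multiple [in RHS]intrD [in RHS]mulrDl -(cotD sp (ss 0%N) sps').
    rewrite [RHS]fmorph_div; congr (_ / _); by rewrite rmorphB rmorph1 [in RHS]rmorphM.
  rewrite IH// => [|j]; last exact: hs.
  rewrite (eta_stepD (phi := phi) p0 (hs 0%N) ps0 st sp sps).
  by ring.
(* Cancellation forces [p] to be 1 or -1, where [eta_step] vanishes; the count then restarts from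
   [s 1]. *)
have hp : p = 1 \/ p = -1.
  by case: (hs 0%N) ps0 => -> /eqP; rewrite addr_eq0 ?opprK => /eqP->; [right|left].
have c1 : cot_coefs p s 1 = - cot_coefs p s 0.
  rewrite /= /cot_multiple; have -> : s 0%N = - p by apply/eqP; rewrite -addr_eq0 addrC ps0.
  by rewrite intrN mulNr cotN rmorphN.
rewrite ps0 add0r in nS *; rewrite (eta_step1 hp st) subr0.
case: k => [|k] in kN pkr nS *.
  rewrite big_ord0 eta_step0 mul0r addr0 eqxx in nS *.
  case: nS => // Su; rewrite (hsig_pencil_cancel2 imag_unit2 conj_imag_unit Hh Sh (cot_coefs_real p s))//.
rewrite (hsig_pencil_cancel imag_unit2 conj_imag_unit Hh Sh _ (cot_coefs_real p s))//.
rewrite (@eq_pencil _ _ _ _ (cot_coefs (s 1%N) (fun j => s j.+2))); last by case.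
have sumE : \sum_(i < k.+1) s' i = s 1%N + \sum_(i < k) s i.+2 by rewrite big_ord_recl.
rewrite {}sumE in nS *; rewrite IH//.
- by rewrite (eta_step1 (hs 1%N) st) subr0.
- by lia.
- by case: (hs 1%N) => ->.
- by have := hs 1%N; lia.
Qed.

End Count.

(** * Twisted matrices in terms of the pencil, and the theorem *)

Section Assembly.
Variable R : realType.
Local Notation C := R[i].
Local Notation im := (imag_unit R).

Lemma one_sub_cexpi (x : R) : sin x != 0 ->
  1 - cexpi (2 * x) = (2 * sin x ^+ 2)%:C%C * (1 - im * (cot x)%:C%C).
Proof.
move=> sx; have -> : 2 * x = x + x by ring.
apply/eqP; rewrite eq_complex /= cosD sinD; apply/andP; split; apply/eqP.
  rewrite /= !(mul0r, mulr0, mul1r, mulr1, subr0, addr0, add0r).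
  by have := cos2Dsin2 x; lra.
rewrite /= !(mul0r, mulr0, mul1r, mulr1, subr0, addr0, add0r).
by rewrite /cot; field.
Qed.

Lemma one_sub_cexpiN (x : R) : sin x != 0 ->
  1 - cexpi (- (2 * x)) = (2 * sin x ^+ 2)%:C%C * (1 + im * (cot x)%:C%C).
Proof.
move=> sx; have := @one_sub_cexpi (- x).
by rewrite sinN oppr_eq0 sqrrN mulrN cotN rmorphN mulrN opprK; apply.
Qed.

Variables (eps : int) (z : C).
Hypotheses (epsE : eps = 1 \/ eps = -1) (zE : z^* = eps%:~R * z).

Let eps2 : eps%:~R * eps%:~R = 1 :> C.
Proof. by case: epsE => ->; rewrite ?mulrNN mulr1. Qed.

Variables (m : nat) (A : 'M[rat]_m).
Definition herm_part : 'M[C]_m := z *: (ratmx R A + eps%:~R *: (ratmx R A)^T).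
Definition skew_part : 'M[C]_m := (- im * z) *: (ratmx R A - eps%:~R *: (ratmx R A)^T).
Local Notation H := herm_part.
Local Notation S := skew_part.

Let conj_ratr (q : rat) : (ratr q : C)^* = ratr q.
Proof. exact: fmorph_rat. Qed.

Lemma herm_part_adj : H ^t* = H.
Proof.
apply/matrixP => i j; rewrite !mxE.
move: (ratr (A i j)) (ratr (A j i)) (conj_ratr (A i j)) (conj_ratr (A j i)) => a b aE bE.
rewrite rmorphM rmorphD rmorphM rmorph_int /= zE aE bE.
have -> : eps%:~R * z * (b + eps%:~R * a) = z * (eps%:~R * eps%:~R * a + eps%:~R * b) by ring.
by rewrite eps2 mul1r.
Qed.

Lemma skew_part_adj : S ^t* = S.
Proof.
apply/matrixP => i j; rewrite !mxE.
move: (ratr (A i j)) (ratr (A j i)) (conj_ratr (A i j)) (conj_ratr (A j i)) => a b aE bE.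
rewrite rmorphM rmorphM rmorphB rmorphM rmorphN rmorph_int /= conj_imag_unit zE aE bE opprK.
have -> : im * (eps%:~R * z) * (b - eps%:~R * a) =
  - im * z * (eps%:~R * eps%:~R * a - eps%:~R * b) by ring.
by rewrite eps2 mul1r.
Qed.

Lemma twisted_mxE (x : R) : sin x != 0 ->
  z *: twisted_mx eps A (2 * x) = (2 * sin x ^+ 2)%:C%C *: (H + (cot x)%:C%C *: S).
Proof.
move=> sx; rewrite /twisted_mx /herm_part /skew_part.
rewrite (one_sub_cexpi sx) (one_sub_cexpiN sx).
move: (ratmx R A) ((2 * sin x ^+ 2)%:C)%C ((cot x)%:C)%C (eps%:~R : C) => B k c e.
apply/matrixP => i j; rewrite [LHS]mxE [RHS]mxE !mxE.
by move: (B i j) (B j i) => a b; ring.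
Qed.

(** Above the diagonal the coefficients 1 - i cot x and 1 + i cot x fall on the same block and add
    up to 2, leaving 2 z A = H + i S; below it H - i S arises likewise. On the diagonal, exchanging
    A and eps A^T reverses S, whence the sign s_i. *)
Lemma twisted_ialphaE (x : R) r (s : 'I_r -> int) (c : nat -> C) : sin x != 0 ->
  (forall i, s i = 1 \/ s i = -1) ->
  (forall i : 'I_r, c i = (s i)%:~R * (cot x)%:C%C) ->
  z *: twisted_mx eps (ialpha eps s A) (2 * x) =
  (2 * sin x ^+ 2)%:C%C *: pencil_form H S (const_mx 1) (pencil im r c).
Proof.
move=> sx hs cE; apply/matrixP => i' j'.
rewrite !mxE (one_sub_cexpi sx) (one_sub_cexpiN sx) big_ord1 !mxE rmorph1 mulr1 mul1r.
set i := tagnat.sig1 i'; set j := tagnat.sig1 j'.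
move: (tagnat.sig2 i' : 'I_m) (tagnat.sig2 j' : 'I_m) => u v.
move: ((2 * sin x ^+ 2)%:C)%C ((cot x)%:C)%C cE => k c0 cE.
have epsr q : ratr (eps%:~R * q) = eps%:~R * ratr q :> C by rewrite rmorphM /= ratr_int.
have [a aD] : {a : C | ratr (A u v) = a} by eexists.
have [b bD] : {b : C | ratr (A v u) = b} by eexists.
move: (epsr (A u v)) (epsr (A v u)); rewrite !aD !bD => aE bE.
have e2 := eps2; have i2 := imag_unit2 R.
move: (eps%:~R : C) aE bE e2 => e aE bE e2.
have [ij|ji|/val_inj ij] := ltngtP i j.
- rewrite !mxE aE aD.
  have -> : z * (k * (1 - im * c0) * a + e * (k * (1 + im * c0) * (e * a))) =
    k * z * ((1 - im * c0) * a + (1 + im * c0) * ((e * e) * a)) by ring.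
  have -> : k * (z * (a + e * b) + im * (- im * z * (a - e * b))) =
    k * z * (a + e * b - (im * im) * (a - e * b)) by ring.
  by rewrite e2 i2; ring.
- rewrite !mxE bE bD.
  have -> : k * (z * (a + e * b) + - im * (- im * z * (a - e * b))) =
    k * z * (a + e * b + (im * im) * (a - e * b)) by ring.
  by rewrite i2; ring.
- rewrite -ij cE; case: (hs i) => ->; rewrite ?eqxx /=; first by rewrite aD bD; ring.
  rewrite !mxE aE bE.
  have -> : z * (k * (1 - im * c0) * (e * b) + e * (k * (1 + im * c0) * (e * a))) =
    k * z * ((1 - im * c0) * (e * b) + (1 + im * c0) * ((e * e) * a)) by ring.
  by rewrite e2; ring.
Qed.

Lemma twisted_mx0 : twisted_mx eps A (0 : R) = 0.
Proof.
have c0 : cexpi (0 : R) = 1 by rewrite /cexpi cos0 sin0.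
by rewrite /twisted_mx oppr0 c0 subrr !scale0r scaler0 addr0.
Qed.

Lemma cexpi_neq1_sin (x : R) : cexpi (2 * x) <> 1 -> sin x != 0.
Proof.
move=> neq1; apply: contra_notN neq1 => /eqP sx0.
have := cos2Dsin2 x; rewrite sx0 expr0n addr0 => c2.
have -> : 2 * x = x + x by ring.
by rewrite /cexpi cosD sinD sx0 !mul0r mulr0 addr0 subr0 -expr2 c2.
Qed.

Lemma hsig_real_scale n (k : R) (K : 'M[C]_n) : 0 < k -> K ^t* = K ->
  hsig (k%:C%C *: K) = hsig K.
Proof. by move=> k0; apply: hsigZ; rewrite ltcR. Qed.

Lemma absz_sum_le r (s : 'I_r -> int) : (forall i, s i = 1 \/ s i = -1) ->
  (`|(\sum_i s i)%R| <= r)%N.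
Proof.
elim: r s => [|r IH] s hs; first by rewrite big_ord0.
rewrite big_ord_recl; have := IH _ (fun i => hs (lift ord0 i)); have := hs ord0.
by move: (\sum_i _) => n; lia.
Qed.

Lemma hsig_ialpha r (s : 'I_r -> int) (phi : R) : z != 0 ->
  (forall i, s i = 1 \/ s i = -1) ->
  (forall k : nat, (1 <= k <= r)%N -> cexpi (k%:R * phi) <> 1) ->
  \sum_i s i <> 0 \/ A - eps%:~R *: A^T \in unitmx ->
  hsig (z *: twisted_mx eps (ialpha eps s A) phi) =
    eta_step (\sum_i s i) phi * hsig S + hsig (z *: twisted_mx eps A ((\sum_i s i)%:~R * phi)).
Proof.
move=> z0 hs hphi hA; pose t := phi / 2.
have phiE (a : R) : a * phi = 2 * (a * t) by rewrite /t; field.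
have sin_t (k : nat) : (0 < k <= r)%N -> sin (k%:R * t) != 0.
  by move=> /hphi; rewrite phiE; apply: cexpi_neq1_sin.
have Su : \sum_i s i != 0 \/ S \in unitmx.
  case: hA => [/eqP|hu]; [by left|right].
  rewrite unitmxZ; last first.
    rewrite unitfE mulf_neq0// oppr_eq0; apply: contra_eq_neq (imag_unit2 R) => ->.
    by rewrite mul0r eq_sym oppr_eq0 oner_eq0.
  have -> : ratmx R A - eps%:~R *: (ratmx R A)^T = ratmx R (A - eps%:~R *: A^T).
    by apply/matrixP => i j; rewrite !mxE rmorphB rmorphM /= ratr_int.
  by rewrite map_unitmx.
have posk (x : R) : sin x != 0 -> 0 < 2 * sin x ^+ 2.
  by move=> sx; rewrite mulr_gt0// lt_neqAle sqr_ge0 andbT eq_sym expf_neq0.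
(* For [r = 0] no sine is known to be nonzero, but both matrices vanish. *)
case: r => [|k] in s hs hphi hA sin_t Su *.
  have -> : \sum_i s i = 0 by rewrite big_ord0.
  rewrite mul0r twisted_mx0 scaler0 hsig0 eta_step0 mul0r addr0.
  have -> : twisted_mx eps (ialpha eps s A) phi = 0 by apply/matrixP => i; case: (tagnat.sig1 i).
  by rewrite scaler0 hsig0.
have st : sin t != 0 by have := sin_t 1%N isT; rewrite mul1r.
(* Beyond the given range the default 1 is again a sign, as [hsig_pencil] requires. *)
pose s' (i : nat) : int := if insub i is Some i then s i else 1.
have s'E (i : 'I_k.+1) : s' i = s i by rewrite /s' valK.
have hs' i : s' i = 1 \/ s' i = -1.
  by rewrite /s'; case: insub => [j|]; [exact: hs|left].
have sumE : \sum_i s i = s' 0%N + \sum_(i < k) s' i.+1.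
  by rewrite -(eq_bigr _ (fun i _ => s'E i)) big_ord_recl.
have phi2 : phi = 2 * t by rewrite /t; field.
rewrite {1}phi2 (@twisted_ialphaE _ _ _ (cot_coefs phi (s' 0%N) (fun i => s' i.+1)) st hs); last first.
  move=> i; have -> : cot_coefs phi (s' 0%N) (fun i => s' i.+1) i = cot_multiple phi (s i).
    by rewrite -s'E; case: i => -[].
  rewrite /cot_multiple; case: (hs i) => ->; rewrite -/t; first by rewrite !mul1r.
  by rewrite mulN1r cotN rmorphN mulN1r.
rewrite hsig_real_scale ?posk//; last first.
  apply: (pencil_form_adj herm_part_adj skew_part_adj).
  apply: (pencil_herm (conj_imag_unit R)) => j; exact: cot_coefs_real.
rewrite sumE in Su *.
rewrite (hsig_pencil herm_part_adj skew_part_adj sin_t)//.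
(* The first entry starts the count at index 1 or -1, where [eta_step] is 0. *)
- rewrite (eta_step1 (hs' 0%N) st) subr0 addrC; congr (_ + _).
  rewrite -sumE; have [->|n0] := eqVneq (\sum_i s i) 0.
    by rewrite mul0r twisted_mx0 scaler0 hsig0.
  have sn : sin ((\sum_i s i)%:~R * t) != 0.
    by apply: (sin_multiple_neq0 sin_t n0); exact: absz_sum_le.
  rewrite phiE (twisted_mxE sn) hsig_real_scale ?posk//.
  by rewrite adjmxD herm_part_adj adjmxZ conj_real skew_part_adj.
- by case: (hs' 0%N) => ->.
- by have := hs' 0%N; lia.
Qed.

End Assembly.

(** Conjugation is transposition on the hermitian [S], and A - A^T is skew-symmetric. *)
Lemma conj_skew_part1 (R : realType) m (A : 'M[rat]_m) :
  map_mx Num.conj (skew_part 1 (1 : R[i]) A) = - skew_part 1 (1 : R[i]) A.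
Proof.
have z1 : (1 : R[i])^* = 1%:~R * 1 by rewrite rmorph1 mulr1.
have := skew_part_adj (or_introl erefl) z1 A; rewrite -map_trmx.
set S := skew_part _ _ _ => e; rewrite -[LHS]trmxK e /S /skew_part.
by rewrite mulr1z scale1r linearZ linearB /= trmxK -scalerN opprB.
Qed.

Theorem lemma2p2 (R : realType) (m : nat) (A : 'M[rat]_m) (eps : int)
    (heps : eps = 1 \/ eps = -1) (r : nat) (s : 'I_r -> int)
    (hs : forall n : 'I_r, s n = 1 \/ s n = -1) (phi : R)
    (hphi : forall k : nat, (1 <= k <= r)%N -> cexpi (k%:R * phi) <> 1)
    (hA : \sum_n s n <> 0 \/ A - eps%:~R *: A^T \in unitmx) :
  (eps = 1 ->
     sigma_plus (ialpha 1 s A) phi = sigma_plus A ((\sum_n s n)%:~R * phi)) /\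
  (eps = -1 ->
     sigma_minus (ialpha (-1) s A) phi =
       eta_step (\sum_n s n) phi * signature (ratmx R (A + A^T))
       + sigma_minus A ((\sum_n s n)%:~R * phi)).
Proof.
split=> epsE; rewrite epsE in heps hA.
  have zE : (1 : R[i])^* = 1%:~R * 1 by rewrite rmorph1 mulr1.
  rewrite /sigma_plus !signature_hsig -[twisted_mx 1 _ phi]scale1r.
  rewrite (hsig_ialpha heps zE (oner_neq0 _) hs hphi hA) scale1r -[RHS]add0r; congr (_ + _).
  (* Conjugation preserves the signature and turns [S] into its opposite, so the signature of [S] is
     its own negative. *)
  have := hsig_conj (skew_part_adj heps zE A).
  rewrite conj_skew_part1 (hsigN (skew_part_adj heps zE A)) => /eqP.
  by rewrite eq_sym -subr_eq0 opprK -mulr2n mulrn_eq0 => /eqP ->; rewrite mulr0.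
have zE : (imag_unit R)^* = (-1)%:~R * imag_unit R by rewrite conj_imag_unit mulN1r.
have im0 : imag_unit R != 0.
  by apply: contra_eq_neq (imag_unit2 R) => ->; rewrite mul0r eq_sym oppr_eq0 oner_eq0.
rewrite /sigma_minus !signature_hsig.
rewrite (hsig_ialpha heps zE im0 hs hphi hA).
(* Here the scalar -i z is -i i = 1, and [eps = -1] turns the difference into A + A^T. *)
suff -> : skew_part (-1) (imag_unit R) A = ratmx R (A + A^T) by [].
rewrite /skew_part mulNr imag_unit2 opprK scale1r mulrN1z scaleN1r opprK.
by rewrite /ratmx map_mxD map_trmx.
Qed.
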